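(* Let $G=(V,E)$ be the Soccer Ball Graph (SBG). There exist exactly $26$ distinct Identifying Code Sets of $G$ of cardinality $10$.
   Context: For a finite undirected simple graph $G=(V,E)$ and $v\in V$, let $N(v)$ be the set of vertices adjacent to $v$ and $N^+(v)=\{v\}\cup N(v)$. A set $V'\subseteq V$ is an Identifying Code Set (ICS) of $G$ if $N^+(v)\cap V'\neq\varnothing$ for every $v\in V$, and $N^+(v)\cap V'\neq N^+(w)\cap V'$ for all $v,w\in V$ with $v\ne w$. Two ICSes are distinct if they are different as subsets of the labelled vertex set $V$ (symmetries of the graph are not factored out). The Soccer Ball Graph (SBG) has 32 vertices corresponding to the 20 hexagonal and 12 pentagonal faces of a truncated icosahedron, two vertices being adjacent iff the corresponding faces share a boundary edge (90 edges). Explicitly, $V=P\cup H$ with $P=\{P_{1,1}\}\cup\{P_{i,j}: i\in\{3,4\},1\le j\le5\}\cup\{P_{6,1}\}$ and $H=\{H_{i,j}: 2\le i\le 5, 1\le j\le 5\}$. Second indices $j$ (of the vertices with first index $2,\dots,5$) are taken modulo 5 with representatives $1,\dots,5$. The edges are, for all $1\le j\le5$: $\{P_{1,1},H_{2,j}\}$, $\{P_{6,1},H_{5,j}\}$, $\{H_{2,j},H_{2,j+1}\}$, $\{H_{5,j},H_{5,j+1}\}$, $\{H_{3,j},P_{3,j}\}$, $\{P_{3,j},H_{3,j+1}\}$, $\{H_{4,j},P_{4,j+1}\}$, $\{P_{4,j},H_{4,j}\}$, $\{H_{2,j},H_{3,j}\}$, $\{H_{2,j},P_{3,j-1}\}$,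 $\{H_{2,j},P_{3,j}\}$, $\{H_{3,j},P_{4,j}\}$, $\{H_{3,j},H_{4,j-1}\}$, $\{H_{3,j},H_{4,j}\}$, $\{P_{3,j},H_{4,j}\}$, $\{H_{4,j},H_{5,j}\}$, $\{P_{4,j},H_{5,j}\}$, $\{P_{4,j},H_{5,j-1}\}$. *)

(* Defs.v *)
From HB Require Import structures.
From mathcomp Require Import all_boot all_algebra.

Set Implicit Arguments.
Unset Strict Implicit.
Unset Printing Implicit Defensive.

Import GRing.Theory.

Record sgraph := SGraph {
  vertex :> finType;
  adj : rel vertex;
  adj_sym : symmetric adj;
  adj_irr : irreflexive adj }.

Definition nbhd (G : sgraph) (v : G) : {set G} := [set w | adj v w].

Definition cl_nbhd (G : sgraph) (v : G) : {set G} := v |: nbhd v.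

Definition is_ICS (G : sgraph) (C : {set G}) : bool :=
  [forall v : G, cl_nbhd v :&: C != set0] &&
  [forall v : G, forall w : G,
     (v != w) ==> (cl_nbhd v :&: C != cl_nbhd w :&: C)].

(* P* are the pentagonal faces, H* the hexagonal ones.  P1 and P6 stand for
   P_{1,1} and P_{6,1}; elsewhere the second index lives in 'Z_5, so that the
   representative 5 of the labelling 1, ..., 5 is 0. *)
Inductive sbg_vertex :=
  | P1 | P3 of 'Z_5 | P4 of 'Z_5 | P6
  | H2 of 'Z_5 | H3 of 'Z_5 | H4 of 'Z_5 | H5 of 'Z_5.

Definition sbg_code (v : sbg_vertex) : bool + 'I_6 * 'Z_5 :=
  match v with
  | P1 => inl false
  | P6 => inl true
  | P3 j => inr (@Ordinal 6 0 isT, j)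
  | P4 j => inr (@Ordinal 6 1 isT, j)
  | H2 j => inr (@Ordinal 6 2 isT, j)
  | H3 j => inr (@Ordinal 6 3 isT, j)
  | H4 j => inr (@Ordinal 6 4 isT, j)
  | H5 j => inr (@Ordinal 6 5 isT, j)
  end.

Definition sbg_decode (c : bool + 'I_6 * 'Z_5) : sbg_vertex :=
  match c with
  | inl false => P1
  | inl true => P6
  | inr (i, j) =>
    match val i with
    | 0 => P3 j | 1 => P4 j | 2 => H2 j | 3 => H3 j | 4 => H4 j | _ => H5 j
    end
  end.

Lemma sbg_codeK : cancel sbg_code sbg_decode.
Proof. by case. Qed.

HB.instance Definition _ := Finite.copy sbg_vertex (can_type sbg_codeK).

(* Each of the 90 edges in one orientation. *)
Definition sbg_arc (x y : sbg_vertex) : bool :=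
  match x, y with
  | P1, H2 _ => true
  | P6, H5 _ => true
  | H2 j, H2 k => k == (j + 1)%R
  | H5 j, H5 k => k == (j + 1)%R
  | H3 j, P3 k => k == j
  | P3 j, H3 k => k == (j + 1)%R
  | H4 j, P4 k => k == (j + 1)%R
  | P4 j, H4 k => k == j
  | H2 j, H3 k => k == j
  | H2 j, P3 k => (k == (j - 1)%R) || (k == j)
  | H3 j, P4 k => k == j
  | H3 j, H4 k => (k == (j - 1)%R) || (k == j)
  | P3 j, H4 k => k == j
  | H4 j, H5 k => k == j
  | P4 j, H5 k => (k == j) || (k == (j - 1)%R)
  | _, _ => false
  end.

Definition sbg_adj : rel sbg_vertex := fun x y => sbg_arc x y || sbg_arc y x.

Lemma sbg_adj_sym : symmetric sbg_adj.
Proof. by move=> x y; rewrite /sbg_adj orbC. Qed.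

Lemma sbg_adj_irr : irreflexive sbg_adj.
Proof.
by case=> //= j; rewrite /sbg_adj /= orbb -{1}[j]addr0 (inj_eq (addrI j)).
Qed.

Definition SBG : sgraph := SGraph sbg_adj_sym sbg_adj_irr.

(* Main.v *)
(* C is an identifying code iff it meets every closed neighbourhood and every
   symmetric difference of two closed neighbourhoods.  Discarding the sets with
   more than 6 elements leaves 102 sets to be met, few enough for an exhaustive
   branching search: pick a smallest set not yet met and decide which of its
   elements is the first one in C.  The search, run by the kernel, finds 26 sets
   of at most 10 vertices such that every solution contains one of them; all 26
   have exactly 10 elements and satisfy the discarded constraints too. *)

Require Import Defs.
From mathcomp Require Import all_boot zmodp.

Set Implicit Arguments.
Unset Strict Implicit.
Unset Printing Implicit Defensive.

Section HittingSets.
Variable T : eqType.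
Implicit Types (s c : seq T) (cs : seq (seq T)).

Definition hits s cs := all (has (mem s)) cs.

Fixpoint shortest c cs :=
  if cs is d :: cs' then shortest (if size d < size c then d else c) cs' else c.

(** Branching on this constraint loses no solution: a hitting set meets every member of the list. *)
Lemma mem_shortest c cs : shortest c cs \in c :: cs.
Proof.
elim: cs c => [|d cs IHcs] c /=; first exact: mem_head.
have := IHcs (if size d < size c then d else c).
by rewrite !inE; case: ifP => _ /orP[] ->; rewrite ?orbT.
Qed.

(* Elements of c are tried in order; the ones already tried are deleted from cs,
   i.e. assumed not to be chosen. *)
Fixpoint branch (search : seq (seq T) -> seq (seq T)) c cs :=
  if c is x :: c' then
    [seq x :: s | s <- search [seq d <- cs | x \notin d]]
      ++ branch search c' [seq [seq y <- d | y != x] | d <- cs]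
  else [::].

Fixpoint hitting_sets k cs : seq (seq T) :=
  match cs, k with
  | [::], _ => [:: [::]]
  | _ :: _, 0 => [::]
  | c :: cs', k'.+1 => branch (hitting_sets k') (shortest c cs') cs
  end.

(** Let [x] be the first element of the branching constraint that lies in [s]. The constraints
    avoiding [x] are hit by the rest of [s], which has at most [k] elements, so induction applies.
    The search stops once all constraints are hit, so [r] may be smaller than [s]. *)
Lemma hitting_setsP k cs s :
    hits s cs -> size s <= k ->
  exists2 r, r \in hitting_sets k cs & {subset r <= s}.
Proof.
elim: k cs s => [|k IHk] [|c cs] s.
- by exists [::].
- by case: s => //=; rewrite has_pred0.
- by exists [::].
move=> hcs sk; rewrite /hitting_sets -/hitting_sets.
have: has (mem s) (shortest c cs) := allP hcs _ (mem_shortest c cs).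
(* Constraint and list are generalized separately, since [branch] trims them in different ways; [s]
   keeps hitting both. *)
elim: (shortest c cs) (c :: cs) hcs => {c cs} //= x c IHc cs hcs.
have [sx _|s'x /= sc] := boolP (x \in s).
  have [||r rk rs] := IHk [seq d <- cs | x \notin d] (rem x s).
  - apply/allP=> d; rewrite mem_filter => /andP[xd /(allP hcs)/hasP[y dy sy]].
    apply/hasP; exists y => //=; move: sy; rewrite !inE.
    rewrite (perm_mem (perm_to_rem sx)) inE => /predU1P[yx|//].
    by rewrite -yx dy in xd.
  - by rewrite size_rem // -ltnS (leq_trans _ sk) // prednK //; case: (s) sx.
  exists (x :: r); first by rewrite mem_cat map_f.
  by move=> y; rewrite inE => /predU1P[->//|/rs/mem_rem].
(* As [s] avoids [x], deleting [x] from every constraint removes no hit. *)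
have [|//|r rk rs] := IHc [seq [seq y <- d | y != x] | d <- cs].
  rewrite /hits all_map; apply/allP=> d /(allP hcs)/hasP[y dy sy].
  apply/hasP; exists y => //; rewrite mem_filter dy andbT.
  by apply: contraNneq s'x => <-.
by exists r => //; rewrite mem_cat rk orbT.
Qed.

End HittingSets.

Section Constraints.
Variables (G : sgraph) (V : seq G).
Hypothesis memV : forall v, v \in V.

Definition in_ball (v x : G) := (x == v) || adj v x.

Definition cover_constraints := [seq [seq x <- V | in_ball v x] | v <- V].

Definition separation_constraints :=
  [seq [seq x <- V | in_ball p.1 x (+) in_ball p.2 x]
     | p <- [seq (v, w) | v <- V, w <- V] & p.1 != p.2].

Definition ICS_constraints := cover_constraints ++ separation_constraints.

Lemma in_cl_nbhd (v x : G) : (x \in cl_nbhd v) = in_ball v x.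
Proof. by rewrite !inE. Qed.

(** Any list with the elements of [C] is allowed, so this applies both to [enum C] and to the lists
    found by the search. *)
Lemma is_ICS_hits (C : {set G}) s :
  C =i s -> is_ICS C = hits s ICS_constraints.
Proof.
move=> Cs; rewrite /is_ICS /hits all_cat; congr andb.
  rewrite all_map; apply/forallP/allP => [cov v _|cov v].
    have /set0Pn[x] := cov v; rewrite inE in_cl_nbhd Cs => /andP[vx sx].
    by apply/hasP; exists x; rewrite ?mem_filter ?vx ?memV.
  have /hasP[x] := cov v (memV v); rewrite mem_filter => /andP[vx _] sx.
  by apply/set0Pn; exists x; rewrite inE in_cl_nbhd vx Cs.
have sepP (v w : G) : (cl_nbhd v :&: C != cl_nbhd w :&: C) =
    has (mem s) [seq x <- V | in_ball v x (+) in_ball w x].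
  apply/idP/hasP => [/eqP neq_vw|[x]]; last first.
    rewrite mem_filter => /andP[vwx _] /= sx; apply/eqP=> /setP/(_ x).
    rewrite !in_setI !in_cl_nbhd Cs sx !andbT => eqvw.
    by rewrite eqvw addbb in vwx.
  apply/hasP; apply: contra_notT neq_vw => /hasPn no_x; apply/setP=> x.
  rewrite !in_setI !in_cl_nbhd Cs.
  have [sx|] := boolP (x \in s); rewrite ?andbF // !andbT.
  have := contraL (no_x x) sx; rewrite mem_filter memV andbT.
  by case: (in_ball v x); case: (in_ball w x).
rewrite all_map; apply/forallP/allP => [sep [v w]|sep v].
  rewrite mem_filter => /andP[vw _] /=; rewrite -sepP.
  by have /forallP/(_ w)/implyP := sep v; apply.
apply/forallP=> w; apply/implyP=> vw; rewrite sepP.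
by apply: (sep (v, w)); rewrite mem_filter vw; apply: allpairs_f.
Qed.

End Constraints.

Definition sbg_vertices : seq SBG :=
  let Z5 : seq 'Z_5 := [:: inZp 0; inZp 1; inZp 2; inZp 3; inZp 4] in
  P1 :: P6 :: map P3 Z5 ++ map P4 Z5 ++
  map H2 Z5 ++ map H3 Z5 ++ map H4 Z5 ++ map H5 Z5.

Lemma mem_sbg_vertices v : v \in sbg_vertices.
Proof. by case: v => // -[[|[|[|[|[]]]]] ltj5]. Qed.

(** The pairs [(v, w)] and [(w, v)] yield the same list, filtered from one enumeration, so [undup]
    merges them. *)
Definition short_constraints :=
  undup [seq c <- ICS_constraints sbg_vertices | size c <= 6].

Definition sbg_codes : seq (seq SBG) := hitting_sets 10 short_constraints.

(** Comparing membership vectors identifies lists that are reorderings of one set. *)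
Definition code_list_ok (L cs : seq (seq SBG)) :=
  [&& size L == 26,
      uniq [seq [seq v \in s | v <- sbg_vertices] | s <- L] &
      all (fun s => [&& uniq s, size s == 10 & hits s cs]) L].

Lemma sbg_codes_ok : code_list_ok sbg_codes (ICS_constraints sbg_vertices).
Proof. by vm_cast_no_check (erefl true). Qed.

(** Keeping [L] abstract separates the counting argument from the evaluation of the search. *)
Lemma card_codes (L : seq (seq SBG)) :
    code_list_ok L (ICS_constraints sbg_vertices) ->
    (forall s, hits s short_constraints -> size s <= 10 ->
       exists2 r, r \in L & {subset r <= s}) ->
  #|[set C : {set SBG} | is_ICS C & #|C| == 10]| = 26.
Proof.
case/and3P=> /eqP sizeL uniqL /allP okL hitL.
pose toset (s : seq SBG) : {set SBG} := [set v in s].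
have tosetE s : toset s =i s by move=> v; rewrite inE.
have uniq_sets : uniq (map toset L).
  pose char (C : {set SBG}) := [seq v \in C | v <- sbg_vertices].
  apply: (map_uniq (f := char)); rewrite -map_comp.
  rewrite (eq_map (g := fun s => [seq v \in s | v <- sbg_vertices])) //.
  by move=> s; apply: eq_map => v; rewrite tosetE.
rewrite -sizeL -(size_map toset) -(card_uniqP uniq_sets).
apply: eq_card => C; rewrite inE.
apply/andP/mapP => [[icsC /eqP cardC]|[s /okL]].
  have Cs : C =i enum C by move=> v; rewrite mem_enum.
  have hC : hits (enum C) short_constraints.
    apply/allP=> c; rewrite mem_undup mem_filter => /andP[_].
    move: c; apply/allP.
    by rewrite -[all _ _]/(hits _ _) -(is_ICS_hits mem_sbg_vertices Cs).
  have [|r rL rC] := hitL _ hC; first by rewrite -cardE cardC.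
  exists r; first exact: rL.
  have /and3P[uniq_r /eqP size_r _] := okL r rL.
  (* [r] lies inside [C] and both have 10 elements, so they coincide. *)
  apply/esym/eqP; rewrite eqEcard cardC.
  rewrite (eq_card (tosetE r)) (card_uniqP uniq_r) size_r leqnn andbT.
  by apply/subsetP=> v; rewrite tosetE => /rC; rewrite mem_enum.
case/and3P=> uniq_s /eqP size_s hs ->.
rewrite (is_ICS_hits mem_sbg_vertices (tosetE s)).
by rewrite (eq_card (tosetE s)) (card_uniqP uniq_s) size_s.
Qed.

Theorem theorem5 : #|[set C : {set SBG} | is_ICS C & #|C| == 10]| = 26.
Proof.
exact: card_codes sbg_codes_ok (fun s hs => hitting_setsP hs).
Qed.
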